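(* Let $R$ be an integral domain and let $M$ be a Gorenstein projective $R$-module of finite rank. If $M^*=\mathrm{Hom}_R(M,R)$ has finite Gorenstein projective dimension, then $M$ is super finitely presented and $M^*$ is Gorenstein projective.
   Context: For an integral domain $R$ with quotient field $K$, the rank of an $R$-module $M$ is $\dim_K(K\otimes_R M)$. An $R$-module $M$ is super finitely presented if there is an exact sequence $\cdots\to P_n\to\cdots\to P_1\to P_0\to M\to 0$ with every $P_i$ finitely generated projective. An $R$-module $M$ is Gorenstein projective if there is an exact complex of projective $R$-modules $\cdots\to P_1\to P_0\to P^0\to P^1\to\cdots$ with $M\cong\mathrm{im}(P_0\to P^0)$ such that $\mathrm{Hom}_R(-,Q)$ leaves it exact for every projective $R$-module $Q$. The Gorenstein projective dimension is the minimal length of a resolution by Gorenstein projective modules ($\infty$ if none is finite). *)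

(* Defs.v *)
From HB Require Import structures.
From mathcomp Require Import all_boot all_order all_algebra.
Set Implicit Arguments. Unset Strict Implicit. Unset Printing Implicit Defensive.
Import GRing.Theory.
Local Open Scope ring_scope.

Section Defs.
Variable R : idomainType.

Definition islin (U V : lmodType R) (f : U -> V) : Prop :=
  forall (a : R) (x y : U), f (a *: x + y) = a *: f x + f y.

Definition islin_form (M : lmodType R) (f : M -> R) : Prop :=
  forall (a : R) (x y : M), f (a *: x + y) = a * f x + f y.

Definition projective (P : lmodType R) : Prop :=
  forall (A B : lmodType R) (g : A -> B) (f : P -> B),
    islin g -> (forall b, exists a, g a = b) -> islin f ->
    exists h : P -> A, islin h /\ forall x, g (h x) = f x.

Definition fin_gen (M : lmodType R) : Prop :=
  exists s : seq M, forall x : M, exists c : nat -> R,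
    x = \sum_(i < size s) c i *: s`_i.

Definition gorenstein_projective (M : lmodType R) : Prop :=
  exists (X : int -> lmodType R) (d : forall i : int, X i -> X (i + 1)),
    (forall i, projective (X i)) /\
    (forall i, islin (d i)) /\
    (forall i (x : X (i + 1)), d (i + 1) x = 0 <-> exists y : X i, d i y = x) /\
    (exists u : M -> X (0 + 1), islin u /\ injective u /\
       forall z, (exists m, u m = z) <-> (exists y : X 0, d 0 y = z)) /\
    (* Hom_R(-, Q) leaves the complex exact, for every projective Q *)
    (forall Q : lmodType R, projective Q ->
       forall i (f : X (i + 1) -> Q), islin f ->
         (forall y : X i, f (d i y) = 0) ->
         exists g : X (i + 1 + 1) -> Q, islin g /\
           forall x : X (i + 1), f x = g (d (i + 1) x)).

Definition finite_Gpd (M : lmodType R) : Prop :=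
  exists (n : nat) (G : nat -> lmodType R) (e : forall k, G k.+1 -> G k)
         (aug : G 0%N -> M),
    (forall k, gorenstein_projective (G k)) /\
    (forall k, (n < k)%N -> forall x : G k, x = 0) /\
    islin aug /\ (forall k, islin (e k)) /\
    (forall m, exists x, aug x = m) /\
    (forall x, aug x = 0 <-> exists y, e 0%N y = x) /\
    (forall k (x : G k.+1), e k x = 0 <-> exists y, e k.+1 y = x).

Definition super_fp (M : lmodType R) : Prop :=
  exists (P : nat -> lmodType R) (e : forall k, P k.+1 -> P k)
         (aug : P 0%N -> M),
    (forall k, projective (P k) /\ fin_gen (P k)) /\
    islin aug /\ (forall k, islin (e k)) /\
    (forall m, exists x, aug x = m) /\
    (forall x, aug x = 0 <-> exists y, e 0%N y = x) /\
    (forall k (x : P k.+1), e k x = 0 <-> exists y, e k.+1 y = x).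

Definition is_dual (M D : lmodType R) (ev : D -> M -> R) : Prop :=
  (forall x, islin_form (ev x)) /\
  (forall a (x y : D) (m : M), ev (a *: x + y) m = a * ev x m + ev y m) /\
  (forall x y, ev x =1 ev y -> x = y) /\
  (forall f : M -> R, islin_form f -> exists x, ev x =1 f).

Definition Rlin_to_K (M : lmodType R) (W : lmodType {fraction R}) (f : M -> W) :=
  forall (a : R) (x y : M), f (a *: x + y) = (@FracField.tofrac R a) *: f x + f y.

Definition Klin (V W : lmodType {fraction R}) (g : V -> W) :=
  forall a (x y : V), g (a *: x + y) = a *: g x + g y.

Definition is_tensor_K (M : lmodType R) (V : lmodType {fraction R})
    (iota : M -> V) : Prop :=
  Rlin_to_K iota /\
  forall (W : lmodType {fraction R}) (f : M -> W), Rlin_to_K f ->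
    exists g : V -> W, Klin g /\ (forall m, g (iota m) = f m) /\
      forall g' : V -> W, Klin g' -> (forall m, g' (iota m) = f m) -> g' =1 g.

Definition finite_rank (M : lmodType R) : Prop :=
  exists (V : lmodType {fraction R}) (iota : M -> V),
    is_tensor_K iota /\
    exists s : seq V, forall v : V, exists c : nat -> {fraction R},
      v = \sum_(i < size s) c i *: s`_i.

End Defs.

(* Main.v *)
Require Import Defs.
From HB Require Import structures.
From mathcomp Require Import all_boot all_order all_algebra.
From mathcomp Require Import generic_quotient ring_quotient boolp finmap.
From mathcomp.multinomials Require Import monalg.
Set Implicit Arguments. Unset Strict Implicit. Unset Printing Implicit Defensive.
Import GRing.Theory.
Local Open Scope ring_scope.

(** Call N coresolved if it has a coresolution by projectives that stays exact under
    Hom(-, Q) for every projective Q; Gorenstein projectives are coresolved.  Since M has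
    finite rank, its embedding in a projective involves only finitely many coordinates, so
    M has such a coresolution 0 -> M -> R^(k_0) -> R^(k_1) -> ... by finite free modules.
    Its dual is a finite free resolution of D = M^*, which also stays exact under Hom(-, Q),
    so Ext^i(D, Q) = 0 for i >= 1; moreover M is the dual of D.  If D has finite Gorenstein
    dimension, there is an exact sequence 0 -> H -> E -> D -> 0 with E coresolved and H of
    finite projective dimension.  Then Ext^1(D, H) = 0, the sequence splits, and D is
    coresolved as a retract of E.  Splicing the two halves shows that D is Gorenstein
    projective.  The argument that resolved D now applies to the pair (D, M) instead of
    (M, D), and gives the finite free resolution of M. *)

(** * Submodules and quotient modules cut out by a predicate *)

Section SubAndQuotientModule.
Variables (R : idomainType) (V : lmodType R) (S : V -> Prop).
Hypotheses (S0 : S 0) (Slin : forall a x y, S x -> S y -> S (a *: x + y)).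

Definition submod_pred : {pred V} := fun x => `[< S x >].

Fact submod_pred_closed : submod_closed submod_pred.
Proof.
by split=> [|a x y /asboolP Sx /asboolP Sy]; apply/asboolP => //; apply: Slin.
Qed.

HB.instance Definition _ :=
  GRing.isSubmodClosed.Build R V submod_pred submod_pred_closed.

Local Notation Q := (Quotient.quot [the zmodClosed V of submod_pred]).
Local Notation pi := (\pi_Q)%qT.

Fact quot_pi_eq (x y : V) : (pi x = pi y) <-> S (x - y).
Proof.
have piE : (x - y \in submod_pred) = (pi x == pi y) := Quotient.idealrBE _ x y.
split=> [/eqP|Sxy]; first by rewrite -piE => /asboolP.
by apply/eqP; rewrite -piE; apply/asboolP.
Qed.

Fact quot_piD x y : pi (x + y) = pi x + pi y.
Proof. exact: Quotient.pi_add. Qed.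

Definition quot_scale (a : R) (x : Q) : Q := pi (a *: repr x).

Fact quot_scale_pi a x : quot_scale a (pi x) = pi (a *: x).
Proof.
apply: (proj2 (quot_pi_eq _ _)); rewrite -scalerBr -[_ *: _]addr0; apply: Slin => //=.
by apply: (proj1 (quot_pi_eq _ _)); rewrite reprK.
Qed.

Fact quot_scaleA a b x : quot_scale a (quot_scale b x) = quot_scale (a * b) x.
Proof. by elim/quotW: x => x; rewrite (quot_scale_pi b) !quot_scale_pi scalerA. Qed.

Fact quot_scale1 : left_id 1 quot_scale.
Proof. by elim/quotW=> x; rewrite quot_scale_pi scale1r. Qed.

Fact quot_scaleDr : right_distributive quot_scale +%R.
Proof.
move=> a; elim/quotW=> x; elim/quotW=> y.
by rewrite -quot_piD !quot_scale_pi scalerDr quot_piD.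
Qed.

Fact quot_scaleDl v : {morph quot_scale^~ v : a b / a + b}.
Proof.
by elim/quotW: v => v a b /=; rewrite !quot_scale_pi scalerDl quot_piD.
Qed.

HB.instance Definition _ := GRing.Zmodule_isLmodule.Build R Q
  quot_scaleA quot_scale1 quot_scaleDr quot_scaleDl.

Lemma quotient_exists : exists (C : lmodType R) (p : V -> C),
  [/\ islin p, forall c, exists x, p x = c & forall x, p x = 0 <-> S x].
Proof.
exists Q, pi; split.
- by move=> a x y; rewrite quot_piD -quot_scale_pi.
- by move=> c; exists (repr c); rewrite reprK.
- have pi0 : pi 0 = 0 by apply: (addrI (pi 0)); rewrite -quot_piD !addr0.
  by move=> x; have := quot_pi_eq x 0; rewrite subr0 pi0.
Qed.

Definition submodule := {x : V | x \in submod_pred}.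

HB.instance Definition _ := SubType.on submodule.
HB.instance Definition _ := Choice.on submodule.
HB.instance Definition _ := [SubChoice_isSubLmodule of submodule by <:].

Lemma submodule_exists : exists (N : lmodType R) (i : N -> V),
  [/\ islin i, injective i & forall x, S x <-> exists n, i n = x].
Proof.
exists submodule, val; split; [by []|exact: val_inj|].
move=> x; split=> [Sx|[[y Sy] <-]]; last exact/asboolP.
have Sx' : x \in submod_pred by apply/asboolP.
by exists (exist _ x Sx').
Qed.
End SubAndQuotientModule.

(** * Linear maps, short exact sequences and projective modules *)

Section Linear.
Variable R : idomainType.
Implicit Types A B C U V W : lmodType R.

Lemma lin0 U V (f : U -> V) : islin f -> f 0 = 0.
Proof.
by move=> lf; apply: (addrI (f 0)); rewrite -[X in X + _]scale1r -lf scale1r !addr0.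
Qed.

Lemma linD U V (f : U -> V) : islin f -> {morph f : x y / x + y}.
Proof. by move=> lf x y; rewrite -[x]scale1r lf !scale1r. Qed.

Lemma linZ U V (f : U -> V) : islin f -> forall a, {morph f : x / a *: x}.
Proof. by move=> lf a x; rewrite -[a *: x]addr0 lf (lin0 lf) addr0. Qed.

Lemma linN U V (f : U -> V) : islin f -> {morph f : x / - x}.
Proof. by move=> lf x; rewrite -scaleN1r (linZ lf) scaleN1r. Qed.

Lemma linB U V (f : U -> V) : islin f -> {morph f : x y / x - y}.
Proof. by move=> lf x y; rewrite (linD lf) (linN lf). Qed.

Lemma lin_sum U V (f : U -> V) I (r : seq I) (P : pred I) (F : I -> U) :
  islin f -> f (\sum_(i <- r | P i) F i) = \sum_(i <- r | P i) f (F i).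
Proof. by move=> lf; apply: big_morph; [exact: linD|exact: lin0]. Qed.

Lemma lin_inj U V (f : U -> V) :
  islin f -> (forall x, f x = 0 -> x = 0) -> injective f.
Proof.
move=> lf f0 x y fxy; apply/eqP; rewrite -subr_eq0; apply/eqP/f0.
by rewrite (linB lf) fxy subrr.
Qed.

Lemma islin_comp U V W (f : V -> W) (g : U -> V) :
  islin f -> islin g -> islin (fun x => f (g x)).
Proof. by move=> lf lg a x y; rewrite lg lf. Qed.

Lemma islin_add U V (f g : U -> V) :
  islin f -> islin g -> islin (fun x => f x + g x).
Proof. by move=> lf lg a x y; rewrite lg lf scalerDr addrACA. Qed.

Lemma islin_opp U V (f : U -> V) : islin f -> islin (fun x => - f x).
Proof. by move=> lf a x y; rewrite lf scalerN opprD. Qed.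

Lemma islin_zero U V : islin (fun _ : U => 0 : V).
Proof. by move=> a x y; rewrite scaler0 addr0. Qed.

Lemma islin_id U : islin (@id U).
Proof. by []. Qed.

Lemma islin_fst U V W (f : U -> V * W) : islin f -> islin (fun x => (f x).1).
Proof. by move=> lf a x y; rewrite lf. Qed.

Lemma islin_snd U V W (f : U -> V * W) : islin f -> islin (fun x => (f x).2).
Proof. by move=> lf a x y; rewrite lf. Qed.

Lemma islin_pair U V W (f : U -> V) (g : U -> W) :
  islin f -> islin g -> islin (fun x => (f x, g x) : V * W).
Proof. by move=> lf lg a x y; rewrite lg lf. Qed.

(** A set-theoretic section [s] of [p] suffices: since [f] kills the kernel of [p], the value
    [f (s b)] does not depend on the preimage chosen. *)
Lemma lin_factor A B C (p : A -> B) (f : A -> C) :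
    islin p -> (forall b, exists a, p a = b) -> islin f ->
    (forall a, p a = 0 -> f a = 0) ->
  exists g : B -> C, islin g /\ forall a, g (p a) = f a.
Proof.
move=> lp sp lf kp; have [s ps] := choice sp.
have fs a : f (s (p a)) = f a.
  apply/eqP; rewrite -subr_eq0 -(linB lf); apply/eqP/kp.
  by rewrite (linB lp) ps subrr.
exists (fun b => f (s b)); split=> // a x y.
by rewrite -[x]ps -[y]ps -lp !fs lf.
Qed.

Lemma lin_lift_inj A B C (i : A -> B) (f : C -> B) :
    islin i -> injective i -> islin f -> (forall c, exists a, i a = f c) ->
  exists g : C -> A, islin g /\ forall c, i (g c) = f c.
Proof.
move=> li inji lf sf; have [g ig] := choice sf.
by exists g; split=> // a x y; apply: inji; rewrite li !ig lf.
Qed.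

Record ses A B C (i : A -> B) (p : B -> C) : Prop := Ses {
  ses_lini : islin i;
  ses_inj : injective i;
  ses_linp : islin p;
  ses_surj : forall c, exists b, p b = c;
  ses_exact : forall b, p b = 0 <-> exists a, i a = b }.

Lemma ses_comp0 A B C (i : A -> B) (p : B -> C) a : ses i p -> p (i a) = 0.
Proof. by case=> _ _ _ _ ex; apply/ex; exists a. Qed.

Lemma ses_factor A B C W (i : A -> B) (p : B -> C) (f : B -> W) :
    ses i p -> islin f -> (forall a, f (i a) = 0) ->
  exists g : C -> W, islin g /\ forall b, g (p b) = f b.
Proof.
case=> li inji lp sp ex lf fi; apply: lin_factor => // b /ex [a <-]; exact: fi.
Qed.

Lemma ses_lift A B C W (i : A -> B) (p : B -> C) (f : W -> B) :
    ses i p -> islin f -> (forall w, p (f w) = 0) ->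
  exists g : W -> A, islin g /\ forall w, i (g w) = f w.
Proof. by case=> li inji lp sp ex lf pf; apply: lin_lift_inj => // w; apply/ex. Qed.

Lemma cokernel_exists A B (i : A -> B) : islin i -> injective i ->
  exists (C : lmodType R) (p : B -> C), ses i p.
Proof.
move=> li inji.
have [||C [p [lp sp kp]]] := @quotient_exists R B (fun b => exists a, i a = b).
- by exists 0; rewrite (lin0 li).
- by move=> a _ _ [x <-] [y <-]; exists (a *: x + y).
by exists C, p; split.
Qed.

Lemma kernel_exists B C (p : B -> C) : islin p -> (forall c, exists b, p b = c) ->
  exists (A : lmodType R) (i : A -> B), ses i p.
Proof.
move=> lp sp.
have [||A [i [li inji ki]]] := @submodule_exists R B (fun b => p b = 0).
- exact: lin0.
- by move=> a x y px py; rewrite lp px py scaler0 addr0.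
by exists A, i; split.
Qed.

Lemma projective_prod U V : projective U -> projective V -> projective (U * V)%type.
Proof.
move=> pU pV A B g f lg sg lf.
have [|hU [lU eU]] := pU A B g (fun x => f (x, 0)) lg sg.
  by apply: (islin_comp lf); apply: islin_pair => //; apply: islin_zero.
have [|hV [lV eV]] := pV A B g (fun x => f (0, x)) lg sg.
  by apply: (islin_comp lf); apply: islin_pair => //; apply: islin_zero.
exists (fun x => hU x.1 + hV x.2); split.
  by apply: islin_add; apply: islin_comp => //; move=> a x y.
case=> x y; rewrite (linD lg) eU eV -(linD lf).
by rewrite -[X in f X]/(x + 0, 0 + y) addr0 add0r.
Qed.

Lemma projective0 U : (forall x : U, x = 0) -> projective U.
Proof.
move=> U0 A B g f lg sg lf; exists (fun _ => 0); split; first exact: islin_zero.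
by move=> x; rewrite (lin0 lg) (U0 x) (lin0 lf).
Qed.

End Linear.

Ltac lin := repeat first
  [ assumption | apply: islin_id | apply: islin_zero
  | match goal with
    | |- islin (pair 0) => exact: (islin_pair (@islin_zero _ _ _) (@islin_id _ _))
    | |- islin (fun x => _ + _) => apply: islin_add
    | |- islin (fun x => - _) => apply: islin_opp
    | |- islin (fun x => (_, _)) => apply: islin_pair
    | |- islin (fun x => fst _) => apply: islin_fst
    | |- islin (fun x => snd _) => apply: islin_snd
    | H : islin ?f |- islin (fun x => ?f _) => apply: (islin_comp H)
    end ].

(** * Coproper maps and coresolutions *)

Section Coproper.
Variable R : idomainType.
Implicit Types A B C D E G H K N P Q U V W X : lmodType R.

(** For an injective [i] into a projective module this says that Ext^1(coker i, Q) = 0 for every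
    projective [Q]. *)
Definition coproper A B (i : A -> B) : Prop :=
  forall Q, projective Q -> forall f : A -> Q, islin f ->
    exists g : B -> Q, islin g /\ forall a, g (i a) = f a.

Definition coproper_step A C : Prop :=
  exists (X : lmodType R) (i : A -> X) (p : X -> C),
    [/\ projective X, ses i p & coproper i].

(* A greatest fixed point: the class [S] collects the successive cokernels. *)
Definition coresolved N : Prop :=
  exists S : lmodType R -> Prop,
    S N /\ forall A, S A -> exists C, S C /\ coproper_step A C.

Lemma coresolved_step N : coresolved N ->
  exists C, coresolved C /\ coproper_step N C.
Proof.
by case=> S [SN HS]; have [C [SC st]] := HS _ SN; exists C; split=> //; exists S.
Qed.

Lemma coresolved_intro N C : coresolved C -> coproper_step N C -> coresolved N.
Proof.
move=> cC st; exists (fun A => coresolved A \/ A = N); split; first by right.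
move=> A [cA|->]; last by exists C; split=> //; left.
by have [D [cD sD]] := coresolved_step cA; exists D; split=> //; left.
Qed.

Lemma zero_coresolved N : (forall x : N, x = 0) -> coresolved N.
Proof.
move=> N0; exists (fun A => forall x : A, x = 0); split=> // A A0.
exists A; split=> //; exists A, id, id; split; first exact: projective0.
- split=> //; first by move=> c; exists c.
  by move=> b; rewrite (A0 b); split=> // _; exists 0.
- by move=> Q _ f lf; exists f.
Qed.

Lemma projective_coresolved N : projective N -> coresolved N.
Proof.
move=> pN; have [C [p sp]] := cokernel_exists (@islin_id R N) (@inj_id N).
apply: (@coresolved_intro _ C); last first.
  by exists N, id, p; split=> // Q _ f lf; exists f.
apply: zero_coresolved => c; have [b <-] := ses_surj sp c.
by apply/(ses_exact sp); exists b.
Qed.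
End Coproper.

(** * Closure properties of coresolved modules *)

Section Coresolved.
Variable R : idomainType.
Implicit Types A B C D E G H K N P Q U V W X : lmodType R.

(* The horseshoe lemma: the middle term embeds in the sum of the two projectives. *)
Lemma coresolved_extension A E C (i : A -> E) (p : E -> C) :
  ses i p -> coproper i -> coresolved A -> coresolved C -> coresolved E.
Proof.
move=> spE cpi cA cC.
(* The class of all such extensions is stable: the cokernel [E1] of [psi] will again be an
   extension, of [C1] by [A1]. *)
exists (fun E => exists A C (i : A -> E) (p : E -> C),
  [/\ ses i p, coproper i, coresolved A & coresolved C]).
split; first by exists A, C, i, p.
move=> {A E C i p spE cpi cA cC} E [A [C [i [p [spE cpi]]]]].
move=> /coresolved_step [A1 [cA1 [XA [uA [pA [projA sA cuA]]]]]].
move=> /coresolved_step [C1 [cC1 [XC [uC [pC [projC sC cuC]]]]]].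
have [phi [lphi phiE]] := cpi _ projA _ (ses_lini sA).
have li := ses_lini spE; have lp := ses_linp spE.
have luA := ses_lini sA; have lpA := ses_linp sA.
have luC := ses_lini sC; have lpC := ses_linp sC.
pose psi e : (XA * XC)%type := (phi e, uC (p e)).
have lpsi : islin psi by rewrite /psi; lin.
have injpsi : injective psi.
  apply: lin_inj => // e [ph0 /eqP]; rewrite -(lin0 luC) => /eqP /(ses_inj sC).
  move=> /(ses_exact spE) [a ea]; rewrite -ea.
  move: ph0; rewrite -ea phiE -(lin0 luA) => /(ses_inj sA) ->; exact: lin0.
have [E1 [pi spi]] := cokernel_exists lpsi injpsi.
have lpi := ses_linp spi.
have [|a|i1 [li1 i1E]] := @ses_factor R _ _ _ E1 uA pA (fun x => pi (x, 0)) sA.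
- by apply: (islin_comp lpi); lin.
- apply/(ses_exact spi); exists (i a).
  by rewrite /psi phiE (ses_comp0 _ spE) (lin0 luC).
have [|e|p1 [lp1 p1E]] := @ses_factor R _ _ _ C1 psi pi (fun z => pC z.2) spi.
- by lin.
- by rewrite /= (ses_comp0 _ sC).
have s1 : ses i1 p1.
  split=> //.
  - apply: lin_inj => // c; have [x <-] := ses_surj sA c; rewrite i1E.
    move=> /(ses_exact spi) [e [ph /eqP]]; rewrite -(lin0 luC) => /eqP /(ses_inj sC).
    by move=> /(ses_exact spE) [a ea]; rewrite -ph -ea phiE (ses_comp0 _ sA).
  - move=> c; have [y <-] := ses_surj sC c; exists (pi (0, y)); exact: p1E.
  - move=> b; have [[x y] <-] := ses_surj spi b; rewrite p1E /=; split.
    + move=> /(ses_exact sC) [c' <-]; have [e <-] := ses_surj spE c'.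
      exists (pA (x - phi e)); rewrite i1E; apply/eqP; rewrite -subr_eq0 -(linB lpi).
      apply/eqP/(ses_exact spi); exists (- e); rewrite (linN lpsi) /psi.
      by rewrite -[RHS]/(x - phi e - x, 0 - uC (p e)) sub0r addrAC subrr add0r.
    + move=> [a1]; have [x1 <-] := ses_surj sA a1; rewrite i1E => e.
      by rewrite -[pC y]/(pC (x, y).2) -p1E -e p1E /= (lin0 lpC).
exists E1; split.
  exists A1, C1, i1, p1; split=> //.
  move=> Q projQ f lf.
  (* The term [h] on [XC] is chosen so that [f (pA x) + h y] vanishes on the image of [psi] and
     descends to [E1]. *)
  have [|a|k [lk kE]] := @ses_factor R _ _ _ Q i p (fun e => - f (pA (phi e))) spE.
  - by lin.
  - by rewrite phiE (ses_comp0 _ sA) (lin0 lf) oppr0.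
  have [h [lh hE]] := cuC _ projQ _ lk.
  have [|e|g [lg gE]] := @ses_factor R _ _ _ Q psi pi
      (fun z => f (pA z.1) + h z.2) spi.
  - by lin.
  - by rewrite /= hE kE subrr.
  exists g; split=> // a1; have [x <-] := ses_surj sA a1.
  by rewrite i1E gE /= (lin0 lh) addr0.
exists (XA * XC)%type, psi, pi; split=> //; first exact: projective_prod.
move=> Q projQ f lf.
(* The map [f] is extended in two stages: its restriction to [A] over [XA], then the remainder,
   which factors through [C], over [XC]. *)
have [|h [lh hE]] := cuA _ projQ (fun a => f (i a)); first by lin.
have [|a|k [lk kE]] := @ses_factor R _ _ _ Q i p (fun e => f e - h (phi e)) spE.
- by lin.
- by rewrite phiE hE subrr.
have [l [ll lE]] := cuC _ projQ _ lk.
exists (fun z => h z.1 + l z.2); split; first by lin.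
by move=> e; rewrite /= lE kE addrC subrK.
Qed.

Lemma ses_prod A C : ses (fun a : A => (a, 0) : A * C) (fun z => z.2).
Proof.
split; [by lin|by move=> x y []| |by move=> c; exists (0, c)|].
  exact: (islin_snd (@islin_id R (A * C)%type)).
by case=> a c /=; split=> [->|[a' [_ <-]]] //; exists a.
Qed.

Lemma coresolved_prod A C : coresolved A -> coresolved C -> coresolved (A * C)%type.
Proof.
apply: coresolved_extension (ses_prod A C) _ => Q _ f lf.
by exists (fun z => f z.1); split=> //; apply: (islin_comp lf) => a x y.
Qed.

(** As [P] is projective, [q] extends along [u] to [q'] on [X]; with [p] it identifies the cokernel
    of [D -> W -> X] with [C * P]. *)
Lemma coresolved_projective_summand D W P (j : D -> W) (q : W -> P) :
  ses j q -> coproper j -> projective P -> coresolved W -> coresolved D.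
Proof.
move=> sj cj projP /coresolved_step [C [cC [X [u [p [projX su cu]]]]]].
have lu := ses_lini su; have lp := ses_linp su; have lj := ses_lini sj.
have [q' [lq' q'E]] := cu _ projP _ (ses_linp sj).
apply: (@coresolved_intro _ _ (C * P)%type).
  by apply: coresolved_prod => //; apply: projective_coresolved.
exists X, (fun d => u (j d)), (fun x => (p x, q' x)); split=> //.
  split; [by lin| |by lin| |].
  - by move=> x y /(ses_inj su) /(ses_inj sj).
  - move=> [c t]; have [x <-] := ses_surj su c.
    have [w qw] := ses_surj sj (t - q' x); exists (x + u w).
    by rewrite (linD lp) (linD lq') q'E qw (ses_comp0 _ su) addr0 addrC subrK.
  - move=> x; split=> [[/(ses_exact su) [w <-]]|[d <-]].
      by rewrite q'E => /(ses_exact sj) [d <-]; exists d.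
    by rewrite (ses_comp0 _ su) q'E (ses_comp0 _ sj).
move=> Q projQ f lf; have [g [lg gE]] := cj _ projQ _ lf.
by have [h [lh hE]] := cu _ projQ _ lg; exists h; split=> // d; rewrite hE gE.
Qed.

(* [D * X] is a pushout of [G] and [X] along [K], hence an extension of [L] by [G]. *)
Lemma coresolved_cokernel K G D (i : K -> G) (p : G -> D) :
  ses i p -> coproper i -> coresolved K -> coresolved G -> coresolved D.
Proof.
move=> si ci /coresolved_step [L [cL [X [u [q [projX su cu]]]]]] cG.
have lu := ses_lini su; have lq := ses_linp su.
have li := ses_lini si; have lp := ses_linp si.
have [phi [lphi phiE]] := ci _ projX _ lu.
have [|k|r [lr rE]] := @ses_factor R _ _ _ L i p (fun g => q (phi g)) si.
- by lin.
- by rewrite phiE (ses_comp0 _ su).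
have sE : ses (fun g => (p g, phi g) : D * X) (fun z => q z.2 - r z.1).
  split; [by lin| |by lin| |].
  - apply: lin_inj; first by lin.
    move=> g [/(ses_exact si) [k <-]]; rewrite phiE -(lin0 lu) => /(ses_inj su) ->.
    exact: lin0.
  - move=> l; have [x <-] := ses_surj su l; exists (0, x).
    by rewrite /= (lin0 lr) subr0.
  - case=> d x /=; split; last first.
      by move=> [g [<- <-]]; rewrite rE subrr.
    have [g <-] := ses_surj si d; rewrite rE -(linB lq) => /(ses_exact su) [k uk].
    exists (g + i k); rewrite (linD lp) (linD lphi) phiE uk (ses_comp0 _ si).
    by rewrite addr0 addrC subrK.
have cE : coproper (fun g => (p g, phi g) : D * X).
  move=> Q projQ f lf.
  have [|h [lh hE]] := cu _ projQ (fun k => f (i k)); first by lin.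
  have [|k|e [le eE]] := @ses_factor R _ _ _ Q i p (fun g => f g - h (phi g)) si.
  - by lin.
  - by rewrite phiE hE subrr.
  exists (fun z => e z.1 + h z.2); split; first by lin.
  by move=> g; rewrite /= eE subrK.
(* [D] is the kernel of the projection of [D * X] onto the projective module [X]. *)
apply: (coresolved_projective_summand (ses_prod D X)) => //.
  move=> Q projQ f lf; exists (fun z => f z.1); split=> //.
  by apply: (islin_comp lf) => a x y.
exact: coresolved_extension sE cE cG cL.
Qed.

(* For a retract [N] of [W] with embedding [u : W -> X], the cokernel of [N -> X] is a
   retract of the cokernel of [W -> X * X, w |-> (u (j (r w)), u (w - j (r w)))]. *)
Lemma coresolved_retract N W (j : N -> W) (r : W -> N) :
  islin j -> islin r -> cancel j r -> coresolved W -> coresolved N.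
Proof.
move=> lj lr rj cW.
exists (fun N => exists W (j : N -> W) (r : W -> N),
  [/\ islin j, islin r, cancel j r & coresolved W]).
split; first by exists W, j, r.
move=> {N W j r lj lr rj cW} N [W [j [r [lj lr rj cW]]]].
have [C [_ [X [u [p [projX su cu]]]]]] := coresolved_step cW.
have lu := ses_lini su; have injr := can_inj rj.
pose v w : (X * X)%type := (u (j (r w)), u (w - j (r w))).
have lv : islin v.
  by apply: islin_pair; apply: (islin_comp lu); lin.
have injv : injective v.
  apply: lin_inj => // w [/eqP]; rewrite -(lin0 lu) => /eqP /(ses_inj su) ->.
  by rewrite subr0 => /(ses_inj su).
have [C2 [p2 s2]] := cokernel_exists lv injv.
have lp2 := ses_linp s2.
have cv : coproper v.
  move=> Q projQ f lf; have [g [lg gE]] := cu _ projQ _ lf.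
  exists (fun z => g z.1 + g z.2); split; first by lin.
  by move=> w; rewrite /= !gE -(linD lf) addrC subrK.
have cC2 : coresolved C2.
  apply: (coresolved_cokernel s2 cv cW).
  by apply: projective_coresolved; apply: projective_prod.
have [||CN [pN sN]] := @cokernel_exists R N X (fun n => u (j n)).
- by lin.
- by move=> x y /(ses_inj su) /injr.
have lpN := ses_linp sN.
(* The first inclusion and the first projection of [X * X] induce the retraction on cokernels. *)
have [|n|jj [ljj jjE]] := @ses_factor R _ _ _ C2 _ pN (fun x => p2 (x, 0)) sN.
- by apply: (islin_comp lp2); lin.
- by apply/(ses_exact s2); exists (j n); rewrite /v rj subrr (lin0 lu).
have [|w|rr [lrr rrE]] := @ses_factor R _ _ _ CN v p2 (fun z => pN z.1) s2.
- by lin.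
- by rewrite /= (ses_comp0 _ sN).
exists CN; split.
  exists C2, jj, rr; split=> // c; have [x <-] := ses_surj sN c.
  by rewrite jjE rrE.
exists X, (fun n => u (j n)), pN; split=> // Q projQ f lf.
have [|g [lg gE]] := cu _ projQ (fun w => f (r w)); first by lin.
by exists g; split=> // n; rewrite gE rj.
Qed.

(** Only the right half of the complex is read off: the class consists of the images of its
    differentials. The index is shifted so that [d i], required by Hom-exactness at [X (i + 1)], is
    available. *)
Lemma gorenstein_projective_coresolved N :
  gorenstein_projective N -> coresolved N.
Proof.
move=> [X [d [projX [ld [exd [[u [lu [inju uE]]] homd]]]]]].
exists (fun A => exists (i : int) (u : A -> X (i + 1 + 1)),
  [/\ islin u, injective u & forall z, (exists a, u a = z) <->
     exists y : X (i + 1), d (i + 1) y = z]).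
split; first by exists (-1), u; split.
move=> {N u lu inju uE} A [i [u [lu inju uE]]].
have [C [p sp]] := cokernel_exists lu inju.
exists C; split; last first.
  exists (X (i + 1 + 1)), u, p; split=> // Q projQ f lf.
  (* [pA] is [d (i + 1)] with codomain restricted to its image [A]; [f] composed with [pA] kills the
     image of [d i]. *)
  have [|y|pA [lpA pAE]] := @lin_lift_inj R _ _ _ u (d (i + 1)) lu inju.
  - exact: ld.
  - by apply/uE; exists y.
  have [||g [lg gE]] := homd Q projQ i (fun x => f (pA x)).
  - by lin.
  - move=> y; have -> : pA (d i y) = 0; last exact: lin0.
    by apply: inju; rewrite pAE (lin0 lu); apply/exd; exists y.
  exists g; split=> // a; have [|y yE] := (proj1 (uE (u a))); first by exists a.
  by rewrite -yE -gE; congr f; apply: inju; rewrite pAE.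
have kd (z : X (i + 1 + 1)) : d (i + 1 + 1) z = 0 <-> exists a, u a = z.
  by rewrite uE exd.
have [|a|u' [lu' u'E]] := @ses_factor R _ _ _ _ u p (d (i + 1 + 1)) sp.
- exact: ld.
- by apply/kd; exists a.
exists (i + 1), u'; split=> //.
  apply: lin_inj => // c; have [x <-] := ses_surj sp c; rewrite u'E => /kd.
  by move/(ses_exact sp).
move=> z; split=> [[c]|[x <-]]; last by exists (p x).
by have [x <-] := ses_surj sp c => <-; exists x.
Qed.

End Coresolved.

(** * Finite resolutions by coresolved modules and their approximations *)

Section FiniteGorensteinDimension.
Variable R : idomainType.
Implicit Types A B C D E G H K N P Q U V W X Z : lmodType R.

(** A finite left resolution by coresolved modules, cut into short exact sequences to allow
    induction on its length. *)
Inductive finitely_coresolved : lmodType R -> Prop :=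
  | finitely_coresolved0 N : (forall x : N, x = 0) -> finitely_coresolved N
  | finitely_coresolvedS K G N (i : K -> G) (p : G -> N) :
      ses i p -> coresolved G -> finitely_coresolved K -> finitely_coresolved N.

Lemma finite_Gpd_coresolved D : finite_Gpd D -> finitely_coresolved D.
Proof.
move=> [n [G [e [aug [gG [zG [laug [le [saug [exaug exe]]]]]]]]]].
(* Generalized to the module [Z] resolved by the terms from [G k] on; [m] bounds how many of them
   can be nonzero. *)
suff H m k Z (q : G k -> Z) : (n < k + m)%N -> islin q ->
    (forall z, exists x, q x = z) -> (forall x, q x = 0 <-> exists y, e k y = x) ->
    finitely_coresolved Z.
  exact: (H n.+1 0 D aug).
elim: m k Z q => [|m IH] k Z q nkm lq sq exq.
  apply: finitely_coresolved0 => z; have [x <-] := sq z.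
  by rewrite (zG k _ x) ?(lin0 lq) //; move: nkm; rewrite addn0.
have [K [i si]] := kernel_exists lq sq.
have [|x|q' [lq' q'E]] := @ses_lift R _ _ _ _ i q (e k) si.
- exact: le.
- by apply/exq; exists x.
apply: (finitely_coresolvedS si); first exact: gorenstein_projective_coresolved.
apply: (IH k.+1 K q') => //; first by rewrite addSnnS.
- move=> a; have [|y ey] := (proj1 (exq (i a))); first exact: ses_comp0 si.
  by exists y; apply: (ses_inj si); rewrite q'E.
- move=> x; rewrite -exe -q'E; split=> [->|]; first exact: lin0 (ses_lini si).
  by rewrite -(lin0 (ses_lini si)) => /(ses_inj si).
Qed.

Section Acyclic.
Variable S : lmodType R -> Prop.
Hypothesis syzygy : forall D, S D -> exists D1, S D1 /\ coproper_step D1 D.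

(** Given [syzygy], this is Ext^1(D, Z) = 0 for all [D] in [S]. Restricting to coproper [j] makes it
    immediate for projective [Z]. *)
Definition ext_vanishes Z : Prop :=
  forall D1 D P (j : D1 -> P) (q : P -> D), S D1 -> S D ->
    projective P -> ses j q -> coproper j ->
    forall f : D1 -> Z, islin f -> exists g : P -> Z, islin g /\ forall x, g (j x) = f x.

Lemma ext_vanishes_projective Q : projective Q -> ext_vanishes Q.
Proof. by move=> projQ D1 D P j q _ _ _ _ cj; apply: cj. Qed.

Lemma ext_vanishes0 Z : (forall z : Z, z = 0) -> ext_vanishes Z.
Proof. by move=> Z0; apply: ext_vanishes_projective; apply: projective0. Qed.

(** The obstruction lies in Ext^1(D, H). Concretely, a lift [h] of [f q] to [P] maps the syzygy into
    [H]; extending that map over [P] and subtracting it makes [h] descend to [D]. *)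
Lemma ext_vanishes_lift H E Z D (i : H -> E) (p : E -> Z) (f : D -> Z) :
  ses i p -> ext_vanishes H -> S D -> islin f ->
  exists g : D -> E, islin g /\ forall d, p (g d) = f d.
Proof.
move=> sp vH SD lf; have [D1 [SD1 [P [j [q [projP sj cj]]]]]] := syzygy SD.
have lp := ses_linp sp; have li := ses_lini sp.
have lj := ses_lini sj; have lq := ses_linp sj.
have [|h [lh hE]] := projP _ _ p (fun x => f (q x)) lp (ses_surj sp); first by lin.
have [|x|k [lk kE]] := @ses_lift R _ _ _ _ i p (fun x => h (j x)) sp.
- by lin.
- by rewrite hE (ses_comp0 _ sj) (lin0 lf).
have [k' [lk' k'E]] := vH _ _ _ _ _ SD1 SD projP sj cj _ lk.
have [|x|g [lg gE]] := @ses_factor R _ _ _ _ j q (fun x => h x - i (k' x)) sj.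
- by lin.
- by rewrite k'E kE subrr.
exists g; split=> // d; have [x <-] := ses_surj sj d.
by rewrite gE (linB lp) (ses_comp0 _ sp) hE subr0.
Qed.

(** Dimension shifting: the syzygy [D1] lies in [S] itself, so [f] lifts to [E], and the lift
    extends over [P]. *)
Lemma ext_vanishes_quotient H E Z (i : H -> E) (p : E -> Z) :
  ses i p -> ext_vanishes H -> ext_vanishes E -> ext_vanishes Z.
Proof.
move=> sp vH vE D1 D P j q SD1 SD projP sj cj f lf.
have [g [lg gE]] := ext_vanishes_lift sp vH SD1 lf.
have [h [lh hE]] := vE _ _ _ _ _ SD1 SD projP sj cj _ lg.
have lp := ses_linp sp.
by exists (fun x => p (h x)); split=> [|x]; [lin|rewrite hE gE].
Qed.

(** [ext_hull] and [ext_cover] are the two Auslander-Buchweitz approximations, with [ext_vanishes]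
    in the role of finite projective dimension. *)
Definition ext_hull K := exists H C (i : K -> H) (p : H -> C),
  [/\ ses i p, coproper i, ext_vanishes H & coresolved C].

Definition ext_cover K := exists H E (i : H -> E) (p : E -> K),
  [/\ ses i p, ext_vanishes H & coresolved E].

(* The cover is the pushout of [G] and the hull of [K] along [K]. *)
Lemma ext_cover_cokernel K G N (i : K -> G) (p : G -> N) :
  ses i p -> coresolved G -> ext_hull K -> ext_cover N.
Proof.
move=> si cG [H [C [a [c [sa ca vH cC]]]]].
have li := ses_lini si; have lp := ses_linp si.
have la := ses_lini sa; have lc := ses_linp sa.
pose v k : (G * H)%type := (i k, - a k).
have lv : islin v by rewrite /v; lin.
have injv : injective v by move=> x y [/(ses_inj si)].
have [E [pi spi]] := cokernel_exists lv injv.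
have lpi := ses_linp spi.
have [|k|pN [lpN pNE]] := @ses_factor R _ _ _ N v pi (fun z => p z.1) spi.
- by lin.
- by rewrite /= (ses_comp0 _ si).
have [|k|pC [lpC pCE]] := @ses_factor R _ _ _ C v pi (fun z => c z.2) spi.
- by lin.
- by rewrite /= (linN lc) (ses_comp0 _ sa) oppr0.
(* The two sequences of the pushout: [H -> E -> N] is the cover, and [G -> E -> C] shows that [E] is
   coresolved. *)
have sN : ses (fun h => pi (0, h)) pN.
  split=> //.
  - by apply: (islin_comp lpi); lin.
  - apply: lin_inj; first by apply: (islin_comp lpi); lin.
    move=> h /(ses_exact spi) [k [/eqP]]; rewrite -(lin0 li) => /eqP /(ses_inj si) -> <-.
    by rewrite (lin0 la) oppr0.
  - by move=> n; have [g <-] := ses_surj si n; exists (pi (g, 0)); rewrite pNE.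
  - move=> b; have [[g h] <-] := ses_surj spi b; rewrite pNE /=; split.
      move=> /(ses_exact si) [k <-]; exists (h + a k); apply/eqP.
      rewrite -subr_eq0 -(linB lpi); apply/eqP/(ses_exact spi); exists (- k).
      rewrite (linN lv) /v -[RHS]/(0 - i k, h + a k - h) -[LHS]/(- i k, - - a k).
      by rewrite sub0r opprK addrAC subrr add0r.
    by move=> [h' e]; rewrite -[p g]/(p (g, h).1) -pNE -e pNE /= (lin0 lp).
have sC : ses (fun g => pi (g, 0)) pC.
  split=> //.
  - by apply: (islin_comp lpi); lin.
  - apply: lin_inj; first by apply: (islin_comp lpi); lin.
    move=> g /(ses_exact spi) [k [<- /eqP]]; rewrite oppr_eq0 -(lin0 la).
    by move=> /eqP /(ses_inj sa) ->; exact: lin0.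
  - by move=> n; have [h <-] := ses_surj sa n; exists (pi (0, h)); rewrite pCE.
  - move=> b; have [[g h] <-] := ses_surj spi b; rewrite pCE /=; split.
      move=> /(ses_exact sa) [k <-]; exists (g + i k); apply/eqP.
      rewrite -subr_eq0 -(linB lpi); apply/eqP/(ses_exact spi); exists k.
      rewrite /v -[RHS]/(g + i k - g, 0 - a k).
      by rewrite sub0r addrAC subrr add0r.
    by move=> [g' e]; rewrite -[c h]/(c (g, h).2) -pCE -e pCE /= (lin0 lc).
exists H, E, (fun h => pi (0, h)), pN; split=> //.
apply: (coresolved_extension sC) => //.
(* [f] on [G] and an extension [h] of [f i] to [H] agree on [K], so they glue on the pushout. *)
move=> Q projQ f lf; have [|h [lh hE]] := ca _ projQ (fun k => f (i k)); first by lin.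
have [|k|g [lg gE]] := @ses_factor R _ _ _ Q v pi (fun z => f z.1 + h z.2) spi.
- by lin.
- by rewrite /= (linN lh) hE subrr.
by exists g; split=> // x; rewrite gE /= (lin0 lh) addr0.
Qed.

(** Embed [E] in a projective [X] with coresolved cokernel [C]. Then [X / H] contains [E / H], that
    is [N], with quotient [C], and it is Ext-acyclic as a quotient of [X] by [H]. *)
Lemma ext_hull_cover N : ext_cover N -> ext_hull N.
Proof.
move=> [H [E [i [p [sp vH /coresolved_step [C [cC [X [u [c [projX su cu]]]]]]]]]]].
have li := ses_lini sp; have lp := ses_linp sp.
have lu := ses_lini su; have lc := ses_linp su.
have [||H2 [pi spi]] := @cokernel_exists R H X (fun h => u (i h)).
- by lin.
- by move=> x y /(ses_inj su) /(ses_inj sp).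
have lpi := ses_linp spi.
have [|h|a [la aE]] := @ses_factor R _ _ _ H2 i p (fun e => pi (u e)) sp.
- by lin.
- exact: ses_comp0 spi.
have [|h|c2 [lc2 c2E]] := @ses_factor R _ _ _ C _ pi c spi.
- by lin.
- exact: ses_comp0 su.
exists H2, C, a, c2; split=> //.
- split=> //.
  + apply: lin_inj => // n; have [e <-] := ses_surj sp n; rewrite aE.
    by move=> /(ses_exact spi) [h /(ses_inj su) <-]; apply: ses_comp0 sp.
  + by move=> x; have [y <-] := ses_surj su x; exists (pi y).
  + move=> b; have [x <-] := ses_surj spi b; rewrite c2E (ses_exact su); split.
      by move=> [e <-]; exists (p e).
    move=> [n]; have [e <-] := ses_surj sp n; rewrite aE => /eqP.
    rewrite eq_sym -subr_eq0 -(linB lpi) => /eqP /(ses_exact spi) [h ux].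
    by exists (i h + e); rewrite (linD lu) ux subrK.
- move=> Q projQ f lf; have [|g [lg gE]] := cu _ projQ (fun e => f (p e)); first by lin.
  have [|h|k [lk kE]] := @ses_factor R _ _ _ Q _ pi g spi.
  + by lin.
  + by rewrite gE (ses_comp0 _ sp) (lin0 lf).
  exists k; split=> // n; have [e <-] := ses_surj sp n.
  by rewrite aE kE gE.
- exact: (ext_vanishes_quotient spi) (ext_vanishes_projective projX).
Qed.

Lemma finitely_coresolved_ext_hull N : finitely_coresolved N -> ext_hull N.
Proof.
elim=> {N} [N N0|K G N i p si cG _ hK].
  exists N, N, id, (fun=> 0); split.
  - split; [exact: islin_id|exact: inj_id|exact: islin_zero| |].
      by move=> c; exists c; rewrite (N0 c).
    by move=> b; rewrite (N0 b); split=> // _; exists 0.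
  - by move=> Q _ f lf; exists f.
  - exact: ext_vanishes0.
  - exact: zero_coresolved.
by apply: ext_hull_cover; apply: ext_cover_cokernel si cG hK.
Qed.

(* The cover [E -> D] splits, because its kernel is [Ext]-acyclic with respect to [D]. *)
Lemma finitely_coresolved_coresolved D :
  finitely_coresolved D -> S D -> coresolved D.
Proof.
case=> {D} [N N0 _|K G N i p si cG fK SD]; first exact: zero_coresolved.
have [H [E [j [q [sq vH cE]]]]] :=
  ext_cover_cokernel si cG (finitely_coresolved_ext_hull fK).
have [g [lg gE]] := ext_vanishes_lift sq vH SD (@islin_id R N).
exact: coresolved_retract lg (ses_linp sq) gE cE.
Qed.

End Acyclic.
End FiniteGorensteinDimension.

(** * Coordinates on projective modules and finiteness *)

Section FreeCoordinates.
Variable R : idomainType.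
Implicit Types A B C D E G H K N P Q U V W X Z : lmodType R.

Lemma sum_msupp (L : nzRingType) (T : choiceType) (V : lmodType L) (F : T -> V)
    (g : {malg L[T]}) (B : {fset T}) : (msupp g `<=` B)%fset ->
  \sum_(b <- msupp g) g@_b *: F b = \sum_(b <- B) g@_b *: F b.
Proof.
move=> sgB; apply: big_fset_incl => // b _ nb.
by rewrite mcoeff_outdom ?scale0r.
Qed.

(** [{malg R[X]}] is the free module on the set [X]; [i] splits its canonical surjection onto
    [X]. *)
Lemma projective_coordinates X : projective X ->
  exists i : X -> {malg R[X]}, islin i /\
    forall x, \sum_(b <- msupp (i x)) (i x)@_b *: b = x.
Proof.
move=> projX; pose pi (g : {malg R[X]}) : X := \sum_(b <- msupp g) g@_b *: b.
have [|x||i [li ie]] := projX {malg R[X]} X pi id; last by exists i.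
- move=> a x y; pose B := (msupp x `|` msupp y `|` msupp (a *: x + y))%fset.
  have sB z : z \in [:: x; y; a *: x + y] -> (msupp z `<=` B)%fset.
    rewrite !inE => /or3P[]/eqP->; apply/fsubsetP => b; rewrite !in_fsetU => -> //.
    - by rewrite orbT.
    - by rewrite orbT.
  rewrite /pi !(@sum_msupp _ _ _ id _ B); try by apply: sB; rewrite !inE eqxx ?orbT.
  rewrite scaler_sumr -big_split; apply: eq_bigr => b _ /=.
  by rewrite mcoeffD mcoeffZ scalerDl scalerA.
- exists (<< 1 *g x >>); rewrite /pi (@sum_msupp _ _ _ id _ [fset x]%fset); last first.
    exact: msuppU_le.
  by rewrite big_seq_fset1 mcoeffUU scale1r.
- exact: islin_id.
Qed.

Lemma support_coordinates X (i : X -> {malg R[X]}) (B : {fset X}) :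
    islin i -> (forall x, \sum_(b <- msupp (i x)) (i x)@_b *: b = x) ->
  exists k (al : X -> 'rV[R]_k) (be : 'rV[R]_k -> X),
    [/\ islin al, islin be & forall x, (msupp (i x) `<=` B)%fset -> be (al x) = x].
Proof.
move=> li ie; pose s : seq X := B.
exists (size s), (fun x => \row_(j < size s) (i x)@_(s`_j)).
exists (fun v => \sum_(j < size s) v 0 j *: s`_j); split.
- by move=> a x y; apply/rowP => j; rewrite !mxE li mcoeffD mcoeffZ.
- move=> a x y; rewrite scaler_sumr -big_split; apply: eq_bigr => j _ /=.
  by rewrite !mxE scalerDl scalerA.
- move=> x sx; rewrite -[RHS]ie (sum_msupp id sx) -/s (big_nth 0) big_mkord.
  by apply: eq_bigr => j _; rewrite mxE.
Qed.

Lemma msupp_bound (L : nzRingType) (T : choiceType) (s : seq {malg L[T]}) :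
  exists B : {fset T}, forall g, g \in s -> (msupp g `<=` B)%fset.
Proof.
elim: s => [|g s [B sB]]; first by exists fset0.
exists (msupp g `|` B)%fset => h; rewrite inE => /predU1P[->|/sB hB].
  exact: fsubsetUl.
by apply: fsubset_trans hB _; apply: fsubsetUr.
Qed.

Lemma projective_finite_coordinates X (s : seq X) : projective X ->
  exists k (al : X -> 'rV[R]_k) (be : 'rV[R]_k -> X),
    [/\ islin al, islin be & forall x, x \in s -> be (al x) = x].
Proof.
move=> /projective_coordinates [i [li ie]].
have [B sB] := msupp_bound [seq i x | x <- s].
have [k [al [be [lal lbe alK]]]] := support_coordinates B li ie.
by exists k, al, be; split=> // x xs; apply/alK/sB/map_f.
Qed.

(** A substitute for finite rank that finitely generated modules share, so that it passes to the
    cokernels of maps into finite free modules. *)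
Definition finitary N : Prop :=
  forall X (u : N -> X), projective X -> islin u ->
    exists k (al : X -> 'rV[R]_k) (be : 'rV[R]_k -> X),
      [/\ islin al, islin be & forall n, be (al (u n)) = u n].

Lemma row_lin k V (f : 'rV[R]_k -> V) x :
  islin f -> f x = \sum_j x 0 j *: f (delta_mx 0 j).
Proof.
move=> lf; rewrite {1}[x]row_sum_delta (lin_sum _ _ _ lf).
by apply: eq_bigr => j _; rewrite (linZ lf).
Qed.

Lemma islin_row k V (a : 'I_k -> V) : islin (fun x : 'rV[R]_k => \sum_j x 0 j *: a j).
Proof.
move=> c x y; rewrite scaler_sumr -big_split; apply: eq_bigr => j _ /=.
by rewrite !mxE scalerDl scalerA.
Qed.

Lemma projective_row k : projective 'rV[R]_k.
Proof.
move=> A B g f lg sg lf.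
have [a ga] := fin_all_exists (fun j : 'I_k => sg (f (delta_mx 0 j))).
exists (fun x : 'rV[R]_k => \sum_j x 0 j *: a j); split; first exact: islin_row.
move=> x; rewrite (lin_sum _ _ _ lg) (row_lin x lf).
by apply: eq_bigr => j _; rewrite (linZ lg) ga.
Qed.

Lemma fin_gen_row k : fin_gen 'rV[R]_k.
Proof.
pose s : seq 'rV[R]_k := [seq delta_mx 0 j | j <- enum 'I_k].
have sz : size s = k by rewrite size_map size_enum_ord.
exists s => x; exists (fun n => if insub n is Some j then x 0 j else 0).
rewrite sz [LHS]row_sum_delta; apply: eq_bigr => j _.
by rewrite valK (nth_map j) ?size_enum_ord // nth_ord_enum.
Qed.

Lemma finitary_quotient_row k N (p : 'rV[R]_k -> N) :
  islin p -> (forall n, exists x, p x = n) -> finitary N.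
Proof.
move=> lp sp X u projX lu.
have [m [al [be [lal lbe alK]]]] := projective_finite_coordinates
  [seq u (p (delta_mx 0 j)) | j <- enum 'I_k] projX.
exists m, al, be; split=> // n; have [x <-] := sp n.
have l1 : islin (fun x => be (al (u (p x)))) by lin.
have l2 : islin (fun x => u (p x)) by lin.
rewrite (row_lin x l1) (row_lin x l2); apply: eq_bigr => j _.
by rewrite alK //; apply: map_f; rewrite mem_enum.
Qed.

(* If [F] is free on [B], the map [N -> F -> K^(B)] factors through the finite-dimensional
   space [K (x) N], so that its image lies in finitely many coordinates. *)
Lemma finite_rank_finitary N : finite_rank N -> finitary N.
Proof.
move=> [V [iota [[_ univ] [s gens]]]] X u projX lu.
have [i [li ie]] := projective_coordinates projX.
pose f n : {malg {fraction R}[X]} :=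
  [malg b in msupp (i (u n)) => FracField.tofrac (i (u n))@_b].
have fE n b : (f n)@_b = FracField.tofrac (i (u n))@_b.
  rewrite mcoeffE; case: msuppP => // _; by rewrite tofrac0.
have [|g [lg [gE _]]] := univ _ f.
  move=> a x y; apply/malgP => b.
  by rewrite mcoeffD mcoeffZ !fE lu li mcoeffD mcoeffZ tofracD tofracM.
have [B sB] := msupp_bound [seq g v | v <- s].
have [k [al [be [lal lbe alK]]]] := support_coordinates B li ie.
exists k, al, be; split=> // n; apply: alK; apply/fsubsetP => b.
apply: contraLR => nb; rewrite -mcoeff_eq0 -tofrac_eq0 -fE -gE.
have [c ->] := gens (iota n).
rewrite (lin_sum _ _ _ (lg : islin g)) raddf_sum big1 //= => j _.
rewrite (linZ (lg : islin g)) mcoeffZ mcoeff_outdom ?mulr0 //.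
apply: contra nb; apply/fsubsetP/sB/map_f/mem_nth; exact: ltn_ord.
Qed.

(** The image of [n] in a projective module is nonzero, hence so is one of its coordinates. *)
Lemma coresolved_torsionless N (n : N) : coresolved N -> n <> 0 ->
  exists f : N -> R, islin_form f /\ f n <> 0.
Proof.
move=> /coresolved_step [C [_ [X [u [p [projX su _]]]]]] n0.
have lu := ses_lini su.
have [k [al [be [lal lbe alK]]]] := projective_finite_coordinates [:: u n] projX.
have [j xj] : exists j, al (u n) 0 j != 0.
  apply/existsP; apply: contra_notT n0 => /existsPn al0.
  apply: (ses_inj su); rewrite (lin0 lu) -(alK (u n)) ?mem_head //.
  rewrite (_ : al _ = 0) ?(lin0 lbe) //.
  by apply/rowP => j; rewrite mxE; apply/eqP; move/negbNE: (al0 j).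
exists (fun m => al (u m) 0 j); split; last exact/eqP.
by move=> a x y; rewrite lu lal !mxE.
Qed.

End FreeCoordinates.

(** * Duals of finitary coresolved modules *)

Section Duality.
Variable R : idomainType.
Implicit Types A B C D E G H K N P Q U V W X Z : lmodType R.

Lemma projective_regular : projective R^o.
Proof.
move=> A B g f lg sg lf; have [a ga] := sg (f 1).
exists (fun x : R^o => (x : R) *: a); split.
  by move=> c x y; rewrite scalerDl scalerA.
by move=> x; rewrite (linZ lg) ga -(linZ lf) -[_ *: _]/(x * 1) mulr1.
Qed.

Definition dot k (x y : 'rV[R]_k) : R := \sum_j x 0 j * y 0 j.

Lemma dotC k (x y : 'rV[R]_k) : dot x y = dot y x.
Proof. by apply: eq_bigr => j _; rewrite mulrC. Qed.

Lemma dot_linl k a (x x' y : 'rV[R]_k) : dot (a *: x + x') y = a * dot x y + dot x' y.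
Proof.
rewrite mulr_sumr -big_split; apply: eq_bigr => j _ /=.
by rewrite !mxE mulrDl mulrA.
Qed.

Lemma dot_linr k a (x y y' : 'rV[R]_k) : dot x (a *: y + y') = a * dot x y + dot x y'.
Proof. by rewrite dotC dot_linl !(dotC x). Qed.

Lemma row_formE k (f : 'rV[R]_k -> R) :
  islin_form f -> exists x, forall y, f y = dot x y.
Proof.
move=> lf; exists (\row_j f (delta_mx 0 j)) => y.
rewrite (row_lin y (lf : islin (f : _ -> R^o))).
by apply: eq_bigr => j _; rewrite mxE mulrC.
Qed.

(** Since [be] after [al] fixes the image of [u], the map [al u] is still injective, and extensions
    along [u] become extensions along [al u] by composing with [be]. *)
Lemma finitary_step N : coresolved N -> finitary N ->
  exists k (C : lmodType R) (v : N -> 'rV[R]_k) (p : 'rV[R]_k -> C),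
    [/\ ses v p, coproper v, coresolved C & finitary C].
Proof.
move=> cN fN; have [C [cC [X [u [p [projX su cu]]]]]] := coresolved_step cN.
have lu := ses_lini su.
have [k [al [be [lal lbe alK]]]] := fN X u projX lu.
have [||C' [p' s']] := @cokernel_exists R N 'rV[R]_k (fun n => al (u n)).
- by lin.
- by move=> x y e; apply: (ses_inj su); rewrite -alK e alK.
have cv : coproper (fun n => al (u n)).
  move=> Q projQ f lf; have [g [lg gE]] := cu _ projQ _ lf.
  by exists (fun x => g (be x)); split=> [|n]; [lin|rewrite alK gE].
exists k, C', (fun n => al (u n)), p'; split=> //.
- apply: coresolved_cokernel s' cv cN _.
  by apply: projective_coresolved; apply: projective_row.
- exact: finitary_quotient_row (ses_linp s') (ses_surj s').
Qed.

(** [q] is the transpose of [v], with [R^k] identified with its dual by [dot]; it is onto because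
    forms on [N] extend along [v]. *)
Lemma dual_cover k N D (ev : D -> N -> R) (v : N -> 'rV[R]_k) :
    islin v -> coproper v -> is_dual ev ->
  exists q : 'rV[R]_k -> D, [/\ islin q, forall d, exists x, q x = d &
    forall x n, ev (q x) n = dot x (v n)].
Proof.
move=> lv cv [evform [evlin [evinj evsurj]]].
have [|q qE] := @choice _ _ (fun x d => ev d =1 fun n => dot x (v n)).
  by move=> x; apply: evsurj => a n n'; rewrite lv dot_linr.
exists q; split=> //.
  move=> a x y; apply: evinj => n.
  by rewrite evlin !qE dot_linl.
move=> d; have [g [lg gE]] := cv _ projective_regular (ev d) (evform d).
have [x xE] := row_formE (lg : islin_form g).
by exists x; apply: evinj => n; rewrite qE -xE gE.
Qed.

(** Pulled back along [q], [f] is the pairing with a vector [z]. If [p z] were nonzero, a form on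
    [C] not vanishing there would give [x] with [q x = 0] but [dot x z] nonzero. So [z] comes from
    [N]. *)
Lemma dual_reflexive N D (ev : D -> N -> R) (f : D -> R) :
  coresolved N -> finitary N -> is_dual ev -> islin_form f ->
  exists n, forall x, f x = ev x n.
Proof.
move=> cN fN dual lf.
have [k [C [v [p [sv cv cC _]]]]] := finitary_step cN fN.
have [q [lq sq qE]] := dual_cover (ses_lini sv) cv dual.
have [|z zE] := @row_formE k (fun x => f (q x)).
  by move=> a x y; rewrite lq lf.
have [n vn] : exists n, v n = z.
  apply/(ses_exact sv); apply: contrapT => pz0.
  have [h [lh]] := coresolved_torsionless cC pz0; apply.
  have [|x xE] := @row_formE k (fun y => h (p y)).
    by move=> a x y; rewrite (ses_linp sv) lh.
  rewrite xE dotC -zE (_ : q x = 0).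
    exact: (lin0 (lf : islin (f : _ -> R^o))).
  case: dual => _ [evlin [evinj _]]; apply: evinj => n.
  rewrite qE -xE (ses_comp0 _ sv) (lin0 (lh : islin (h : _ -> R^o))).
  by have := evlin (- 1) 0 0 n; rewrite scaler0 addr0 mulN1r addNr.
by exists n => x; have [y <-] := sq x; rewrite zE qE vn dotC.
Qed.

(** Reflexivity represents the forms on [D]; torsionlessness of [N] separates its points. *)
Lemma dual_swap N D (ev : D -> N -> R) : coresolved N -> finitary N ->
  is_dual ev -> is_dual (fun n x => ev x n).
Proof.
move=> cN fN dual; have [evform [evlin [evinj evsurj]]] := dual; split.
  by move=> n a x y; apply: evlin.
split; first by move=> a n n' x; apply: evform.
split; last first.
  move=> f lf; have [n nE] := dual_reflexive cN fN dual lf.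
  by exists n => x; rewrite nE.
move=> n n' e; apply: contrapT => /eqP; rewrite -subr_eq0 => /eqP.
move=> /(coresolved_torsionless cN) [f [lf]]; apply.
have [x xE] := evsurj f lf.
by rewrite (linB (lf : islin (f : _ -> R^o))) -!xE e subrr.
Qed.

Definition dual_class D : Prop := exists N (ev : D -> N -> R),
  [/\ coresolved N, finitary N & is_dual ev].

Lemma dual_finitary N D (ev : D -> N -> R) :
  coresolved N -> finitary N -> is_dual ev -> finitary D.
Proof.
move=> cN fN dual; have [k [C [v [p [sv cv _ _]]]]] := finitary_step cN fN.
have [q [lq sq _]] := dual_cover (ses_lini sv) cv dual.
exact: finitary_quotient_row lq sq.
Qed.

(* Dualizing [0 -> N -> R^k -> C -> 0] gives [0 -> D1 -> R^k -> D -> 0] with [D1] dual to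
   [C]; by reflexivity of [C] the linear forms on [D1] extend to [R^k]. *)
Lemma dual_class_step D : dual_class D -> exists D1, dual_class D1 /\
  exists k (j : D1 -> 'rV[R]_k) (q : 'rV[R]_k -> D), ses j q /\ coproper j.
Proof.
move=> [N [ev [cN fN dual]]].
have [k [C [v [p [sv cv cC fC]]]]] := finitary_step cN fN.
have [q [lq sq qE]] := dual_cover (ses_lini sv) cv dual.
have [D1 [j sj]] := kernel_exists lq sq; have lj := ses_lini sj.
have [s ps] := choice (ses_surj sv); have lp := ses_linp sv.
have evlin := proj1 (proj2 dual).
have ev0 n : ev 0 n = 0.
  by have := evlin (- 1) 0 0 n; rewrite scaler0 addr0 mulN1r addNr.
(* The section [s] is arbitrary: [q (j d) = 0] means that [j d] is orthogonal to the image of [v],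
   so the pairing depends only on [c]. *)
pose ev1 (d : D1) c := dot (j d) (s c).
have ev1E d y : ev1 d (p y) = dot (j d) y.
  have [n vn] : exists n, v n = s (p y) - y.
    by apply/(ses_exact sv); rewrite (linB lp) ps subrr.
  rewrite /ev1 -[s (p y)](subrK y) -vn -[v n]scale1r dot_linr mul1r.
  by rewrite -qE (ses_comp0 _ sj) ev0 add0r.
have dual1 : is_dual ev1.
  split; first by move=> d a c c'; rewrite -[c]ps -[c']ps -lp !ev1E dot_linr.
  split; first by move=> a d d' c; rewrite /ev1 lj dot_linl.
  split=> [d d' e|f lf].
    apply: (ses_inj sj); apply/rowP => i.
    have dE x : dot x (delta_mx 0 i) = x 0 i.
      rewrite /dot (bigD1 i) //= mxE !eqxx mulr1 big1 ?addr0 // => l li.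
      by rewrite mxE (negbTE li) andbF mulr0.
    by rewrite -!dE -!ev1E e.
  have [|x xE] := @row_formE k (fun y => f (p y)).
    by move=> a y y'; rewrite lp lf.
  have [|d dx] := proj1 (ses_exact sj x).
    apply: (proj1 (proj2 (proj2 dual))) => n.
    by rewrite qE ev0 -xE (ses_comp0 _ sv) (lin0 (lf : islin (f : _ -> R^o))).
  by exists d => c; rewrite -[c]ps ev1E dx xE.
exists D1; split; first by exists C, ev1.
exists k, j, q; split=> // Q projQ f lf.
(* As [D1] is finitary, [f] is recovered from the finitely many forms [al (f d) 0 i], each given by
   a vector [w i]. *)
have [m [al [be [lal lbe alK]]]] := dual_finitary cC fC dual1 projQ lf.
have [|w wE] := @choice _ _ (fun (i : 'I_m) (w : 'rV[R]_k) =>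
    forall d, al (f d) 0 i = dot (j d) w).
  move=> i; have [|c cE] := @dual_reflexive _ _ _ (fun d => al (f d) 0 i) cC fC dual1.
    by move=> a d d'; rewrite lf lal !mxE.
  by exists (s c) => d; rewrite cE.
exists (fun x => be (\row_i dot x (w i))); split.
  apply: (islin_comp lbe) => a x y; apply/rowP => i; rewrite !mxE; exact: dot_linl.
move=> d; rewrite -alK; congr be; apply/rowP => i; by rewrite mxE wE.
Qed.

(** * Splicing single steps into infinite resolutions *)

Lemma dependent_choice (T : Type) (S : T -> Prop) (r : T -> T -> Prop) :
    (forall x, S x -> exists y, S y /\ r x y) ->
  forall x, S x -> exists f : nat -> T, f 0 = x /\ forall n, r (f n) (f n.+1).
Proof.
move=> step x Sx.
have next (y : {y | S y}) : {z : {z | S z} | r (sval y) (sval z)}.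
  by apply: cid; case: y => y Sy; have [z [Sz yz]] := step y Sy; exists (exist _ z Sz).
exists (fun n => sval (iter n (fun y => sval (next y)) (exist _ x Sx))).
by split=> // n; rewrite iterS; case: (next _).
Qed.

Lemma dual_class_super_fp D : dual_class D -> super_fp D.
Proof.
move=> dD; have [L [L0 Lr]] := dependent_choice dual_class_step dD.
case: D / L0 dD => _.
have c n : {t : {k & ((L n.+1 -> 'rV[R]_k) * ('rV[R]_k -> L n))%type} |
    ses (projT2 t).1 (projT2 t).2}.
  by apply: cid; have [k [j [q [sj _]]]] := Lr n; exists (existT _ k (j, q)).
pose k n := projT1 (sval (c n)).
pose j n : L n.+1 -> 'rV[R]_(k n) := (projT2 (sval (c n))).1.
pose q n : 'rV[R]_(k n) -> L n := (projT2 (sval (c n))).2.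
have sj n : ses (j n) (q n) := svalP (c n).
exists (fun n => 'rV[R]_(k n)), (fun n x => j n (q n.+1 x)), (q 0).
have ker n x : q n x = 0 <-> exists y, j n (q n.+1 y) = x.
  rewrite (ses_exact (sj n)); split=> [[d <-]|[y <-]]; last by exists (q n.+1 y).
  by have [y <-] := ses_surj (sj n.+1) d; exists y.
split; first by move=> n; split; [apply: projective_row|apply: fin_gen_row].
split; first exact: ses_linp (sj 0).
split; first by move=> n; apply: (islin_comp (ses_lini (sj n)) (ses_linp (sj n.+1))).
split; first exact: ses_surj (sj 0).
split=> [x|n x]; rewrite -ker //; split=> [|->]; last exact: lin0 (ses_lini (sj n)).
by rewrite -(lin0 (ses_lini (sj n))) => /(ses_inj (sj n)).
Qed.

(** The spliced differential is [u p]. A map on [X (i + 1)] that kills the image of [d i] kills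
    [Z (i + 1)], so it factors through [Z (i + 1 + 1)] and extends by coproperness. *)
Lemma coproper_chain_gorenstein (Z : int -> lmodType R) :
  (forall i, coproper_step (Z i) (Z (i + 1))) -> gorenstein_projective (Z (0 + 1)).
Proof.
move=> st.
have c i : {t : {X : lmodType R & ((Z i -> X) * (X -> Z (i + 1)%R))%type} |
    [/\ projective (projT1 t), ses (projT2 t).1 (projT2 t).2 & coproper (projT2 t).1]}.
  by apply: cid; have [X [u [p H]]] := st i; exists (existT _ X (u, p)).
pose X i := projT1 (sval (c i)).
pose u i : Z i -> X i := (projT2 (sval (c i))).1.
pose p i : X i -> Z (i + 1) := (projT2 (sval (c i))).2.
have projX i : projective (X i) by case: (svalP (c i)).
have su i : ses (u i) (p i) by case: (svalP (c i)).
have cu i : coproper (u i) by case: (svalP (c i)).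
exists X, (fun i x => u (i + 1) (p i x)); split=> //.
have im i z : (exists m, u (i + 1) m = z) <-> exists y, u (i + 1) (p i y) = z.
  split=> [[m <-]|[y <-]]; last by exists (p i y).
  by have [y <-] := ses_surj (su i) m; exists y.
have lup i : islin (fun x => u (i + 1) (p i x)).
  exact: (islin_comp (ses_lini (su _)) (ses_linp (su _))).
split=> //; split.
  move=> i x; rewrite -im -(ses_exact (su _)); split=> [|->].
    by rewrite -(lin0 (ses_lini (su (i + 1 + 1)))) => /(ses_inj (su _)).
  exact: lin0 (ses_lini (su _)).
split; first by exists (u (0 + 1)); split; [exact: ses_lini|split; [exact: ses_inj|]].
move=> Q projQ i f lf fd.
have [z|k [lk kE]] := @ses_factor R _ _ _ Q _ _ f (su (i + 1)) lf.
  by have [y <-] := ses_surj (su i) z.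
have [g [lg gE]] := cu (i + 1 + 1) _ projQ _ lk.
by exists g; split=> // x; rewrite gE kE.
Qed.

Lemma dual_class_gorenstein D :
  dual_class D -> coresolved D -> gorenstein_projective D.
Proof.
move=> dD cD; have [L [L0 Lr]] := dependent_choice dual_class_step dD.
have [C [C0 Cr]] := dependent_choice (@coresolved_step R) cD.
(* [D] must stand at index 1. It is both [C 0] and [L 0], so the left half starts with [L 1] at
   index 0 and [L 2] at index -1. *)
pose Z (i : int) := match i with
  | Posz 0 => L 1%N | Posz n.+1 => C n | Negz n => L n.+2 end.
have Lstep n : coproper_step (L n.+1) (L n).
  have [k [j [q [sj cj]]]] := Lr n; exists 'rV[R]_k, j, q; split=> //.
  exact: projective_row.
rewrite -C0; apply: (@coproper_chain_gorenstein Z).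
case=> [[|n]|[|n]].
- by rewrite /= C0 -L0.
- rewrite -[(_ + 1)%R]/(Posz (n.+1 + 1)) addn1; exact: Cr.
- exact: Lstep.
- rewrite (_ : Negz n.+1 + 1 = Negz n); first exact: Lstep.
  by rewrite !NegzE -(addn1 n.+1) PoszD opprD addrNK.
Qed.

End Duality.

Theorem theorem3p6 (R : idomainType) (M D : lmodType R) (ev : D -> M -> R) :
  gorenstein_projective M -> finite_rank M ->
  is_dual ev -> finite_Gpd D ->
  super_fp M /\ gorenstein_projective D.
Proof.
move=> /gorenstein_projective_coresolved cM /finite_rank_finitary fM dual.
move=> /finite_Gpd_coresolved gD.
have dD : dual_class D by exists M, ev.
have syz (E : lmodType R) : dual_class E -> exists E1, dual_class E1 /\ coproper_step E1 E.
  move=> /dual_class_step [E1 [dE1 [k [j [q [sj cj]]]]]]; exists E1; split=> //.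
  by exists 'rV[R]_k, j, q; split=> //; apply: projective_row.
have cD := finitely_coresolved_coresolved syz gD dD.
split; last exact: dual_class_gorenstein.
(* The roles are exchanged: [D], now known to be coresolved, serves as the predual of [M]. *)
apply: dual_class_super_fp; exists D, (fun n x => ev x n); split=> //.
  exact: dual_finitary cM fM dual.
exact: dual_swap.
Qed.
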